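(* Let $X_1,\dots,X_T\in\mathbb R^{d\times l}$ be data matrices, $t_1,\dots,t_T\in[0,1]$ time points, and consider minimizing $$f(Q,\Theta)=-\sum_{i=1}^T\|X_i^TQZ_i\|_F^2,\qquad Z_i=Z_i(\Theta)=\begin{bmatrix}\cos(\Theta t_i)\\ \sin(\Theta t_i)\end{bmatrix}\in\mathbb R^{2k\times k},$$ over $Q=(H,Y)\in\mathcal V^{d\times2k}$ and diagonal matrices $\Theta=\mathrm{diag}(\theta_1,\dots,\theta_k)\in\mathbb R^{k\times k}$. Let $\lambda_Q,\lambda_\Theta\ge0$ and let $\boldsymbol\theta_n=(Q_n,\Theta_n)$ be generated, from an arbitrary initialization, by $$Q_{n+1}=WV^T,\quad\text{where }W\Sigma V^T\text{ is the SVD of }\lambda_QQ_n-\nabla_Qf(Q_n,\Theta_n),$$ $$(\theta_j)_{n+1}=(\theta_j)_n-\frac{1}{w_j((\theta_j)_n)+\lambda_\Theta}\,\nabla f^{(2)}_{n+1,j}((\theta_j)_n),\quad j=1,\dots,k,$$ with $f^{(2)}_{n+1,j}$ and $w_j$ (computed from $Q_{n+1}$) as defined in the context. Then the limit points of $(\boldsymbol\theta_n)_{n\ge0}$ are stationary points of the problem of minimizing $f(Q,\Theta)$. Moreover, if $\lambda_Q,\lambda_\Theta>0$, then the worst-case iteration complexity is $N_\varepsilon=\widetilde O(\varepsilon^{-2})$.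
   Context: $\mathcal V^{d\times2k}=\{Q\in\mathbb R^{d\times 2k}:Q^TQ=I_{2k}\}$ is the Stiefel manifold; $Q=(H,Y)$ with $H,Y\in\mathbb R^{d\times k}$. $\nabla_Qf=-2\sum_{i=1}^TX_iX_i^TQZ_iZ_i^T$ is the Euclidean gradient in $Q$. $\cos(\Theta t_i)$, $\sin(\Theta t_i)$ are the diagonal matrices with entries $\cos(\theta_jt_i)$, $\sin(\theta_jt_i)$. For $Q=(H,Y)$ set $\alpha_{i,j}=[H^TX_iX_i^TH]_{j,j}$, $\beta_{i,j}=[Y^TX_iX_i^TH]_{j,j}$, $\gamma_{i,j}=[Y^TX_iX_i^TY]_{j,j}$, $\phi_{i,j}=\operatorname{arctan2}\big(\beta_{i,j},\frac{\alpha_{i,j}-\gamma_{i,j}}2\big)$ (the angle of the point $(\frac{\alpha_{i,j}-\gamma_{i,j}}2,\beta_{i,j})$ from the positive $x$-axis), $r_{i,j}=\sqrt{\big(\frac{\alpha_{i,j}-\gamma_{i,j}}2\big)^2+\beta_{i,j}^2}$, $b_{i,j}=\frac{\alpha_{i,j}+\gamma_{i,j}}2$; so $f(Q,\Theta)=-\sum_{i,j}\big(r_{i,j}\cos(2\theta_jt_i-\phi_{i,j})+b_{i,j}\big)$. With the subscript $n+1$ denoting values at $Q_{n+1}$, $f^{(2)}_{n+1,j}(\theta)=-\sum_{i=1}^T\big((r_{i,j})_{n+1}\cos(2\theta t_i-(\phi_{i,j})_{n+1})+(b_{i,j})_{n+1}\big)$, whose derivative is $\nabla f^{(2)}_{n+1,j}(\theta)=2\sum_{i=1}^T(r_{i,j})_{n+1}t_i\sin(2\theta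 t_i-(\phi_{i,j})_{n+1})$. The weighting function is $w_j=\sum_{i=1}^Tw_{f_{i,j}}$ with $w_{f_{i,j}}(\theta)=4(r_{i,j})_{n+1}t_i^2\,\frac{\sin u}{u}$, where $u\in[-\pi,\pi)$ is $2\theta t_i-(\phi_{i,j})_{n+1}$ reduced modulo $2\pi$ (and $\frac{\sin0}0:=1$); with it, $f^{(2)}_{n+1,j}(s)+\nabla f^{(2)}_{n+1,j}(s)(\theta-s)+\frac{w_j(s)}2(\theta-s)^2$ majorizes $f^{(2)}_{n+1,j}(\theta)$. The updates are assumed to be well defined. A point $(Q,\Theta)$ is $\varepsilon$-stationary if $\|\mathrm{grad}_Qf(Q,\Theta)\|+\|\nabla_\Theta f(Q,\Theta)\|\le\varepsilon$, where $\mathrm{grad}_Q$ is the Riemannian gradient on $\mathcal V^{d\times2k}$ and $\nabla_\Theta$ is the gradient in $(\theta_1,\dots,\theta_k)\in\mathbb R^k$; it is stationary if this holds with $\varepsilon=0$. $N_\varepsilon=\sup_{\boldsymbol\theta_0}\inf\{n\ge1:\boldsymbol\theta_n\text{ is }\varepsilon\text{-stationary}\}$, and $\widetilde O(\cdot)$ means $O(\cdot)$ as $\varepsilon\to0^+$ up to logarithmic factors. *)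

(* Defs.v *)
From HB Require Import structures.
From mathcomp Require Import all_boot all_order all_algebra.
From mathcomp Require Import all_classical all_reals all_analysis.

Set Implicit Arguments.
Unset Strict Implicit.
Unset Printing Implicit Defensive.

Import Order.TTheory GRing.Theory Num.Theory.
Import numFieldNormedType.Exports.

Local Open Scope classical_set_scope.
Local Open Scope ring_scope.

Section Generic.
Variable R : realType.

Definition frob_dot m n (A B : 'M[R]_(m, n)) : R := \tr (A^T *m B).

(* The library norm `|A| on matrices is the sup norm, hence this one; on row
   vectors it is the Euclidean norm. *)
Definition frob_norm m n (A : 'M[R]_(m, n)) : R := Num.sqrt (frob_dot A A).

Definition stiefel d p : set 'M[R]_(d, p) := [set Q | Q^T *m Q = 1%:M].

Definition stiefel_tangent d p (Q : 'M[R]_(d, p)) : set 'M[R]_(d, p) :=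
  [set E | Q^T *m E + E^T *m Q = 0].

(* Reduced SVD of an m x n matrix (m >= n), with the singular values in s. *)
Definition is_svd m n (M W : 'M[R]_(m, n)) (s : 'rV[R]_n) (V : 'M[R]_n) : Prop :=
  [/\ W^T *m W = 1%:M, V^T *m V = 1%:M, (forall i, 0 <= s 0 i)
    & M = W *m diag_mx s *m V^T].

(* Angle in ]-pi, pi] of the point (x, y); atan2 0 0 = 0. *)
Definition atan2 (y x : R) : R :=
  if 0 < x then atan (y / x)
  else if x < 0 then (if 0 <= y then atan (y / x) + pi else atan (y / x) - pi)
  else if 0 < y then pi / 2
  else if y < 0 then - (pi / 2)
  else 0.

(* Representative of x modulo 2 pi in [-pi, pi[. *)
Definition wrap_angle (x : R) : R :=
  x - 2 * pi * (Num.floor ((x + pi) / (2 * pi)))%:~R.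

Definition sinc (u : R) : R := if u == 0 then 1 else sin u / u.

(* g(e) = O~(h(e)) as e -> 0+: big-O up to a power of log(1/e). *)
Definition soft_bigO (g : R -> \bar R) (h : R -> R) : Prop :=
  exists (C : R) (p : nat),
    \forall e \near 0^'+, (g e <= (C * h e * ln e^-1 ^+ p)%:E)%E.

End Generic.

Section Problem.
Variables (R : realType) (d l k T : nat).
Variables (X : 'I_T -> 'M[R]_(d, l)) (t : 'I_T -> R).

(* Q = (H, Y) = row_mx H Y, so 2k is written k + k. The diagonal matrix
   Theta = diag(theta_1, ..., theta_k) is given by its diagonal th. *)
Local Notation Qmx := 'M[R]_(d, k + k).
Local Notation angles := 'rV[R]_k.

Definition Zmat (th : angles) (i : 'I_T) : 'M[R]_(k + k, k) :=
  col_mx (diag_mx (\row_j cos (th 0 j * t i)))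
         (diag_mx (\row_j sin (th 0 j * t i))).

Definition objective (Q : Qmx) (th : angles) : R :=
  - \sum_(i < T) frob_norm ((X i)^T *m Q *m Zmat th i) ^+ 2.

(* The Euclidean gradient of objective in Q, in closed form. *)
Definition nablaQ (Q : Qmx) (th : angles) : Qmx :=
  - 2 *: \sum_(i < T) (X i *m (X i)^T *m Q *m Zmat th i *m (Zmat th i)^T).

(* The Riemannian gradient at Q of objective(., th) restricted to the Stiefel
   manifold with the metric induced by the Frobenius inner product: the tangent
   vector representing the differential on the tangent space. *)
Definition is_riemannian_gradQ (Q : Qmx) (th : angles) (G : Qmx) : Prop :=
  stiefel_tangent Q G /\
  forall E, stiefel_tangent Q E ->
    frob_dot G E = 'D_E (fun Q' => objective Q' th) Q.

Definition nablaTheta (Q : Qmx) (th : angles) : angles :=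
  \row_j 'D_(delta_mx 0 j) (objective Q) th.

Definition eps_stationary (e : R) (p : Qmx * angles) : Prop :=
  stiefel p.1 /\
  exists2 G, is_riemannian_gradQ p.1 p.2 G
    & frob_norm G + frob_norm (nablaTheta p.1 p.2) <= e.

Definition stationary (p : Qmx * angles) : Prop := eps_stationary 0 p.

(* In polar form (rr, phi) of ((alpha - gamma) / 2, beta), the objective
   separates over the angles: objective Q th = \sum_j f2 Q j (th 0 j). *)
Definition alpha (Q : Qmx) (i : 'I_T) (j : 'I_k) : R :=
  ((lsubmx Q)^T *m X i *m (X i)^T *m lsubmx Q) j j.

Definition beta (Q : Qmx) (i : 'I_T) (j : 'I_k) : R :=
  ((rsubmx Q)^T *m X i *m (X i)^T *m lsubmx Q) j j.

Definition gamma (Q : Qmx) (i : 'I_T) (j : 'I_k) : R :=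
  ((rsubmx Q)^T *m X i *m (X i)^T *m rsubmx Q) j j.

Definition phi (Q : Qmx) (i : 'I_T) (j : 'I_k) : R :=
  atan2 (beta Q i j) ((alpha Q i j - gamma Q i j) / 2).

Definition rr (Q : Qmx) (i : 'I_T) (j : 'I_k) : R :=
  Num.sqrt (((alpha Q i j - gamma Q i j) / 2) ^+ 2 + beta Q i j ^+ 2).

Definition bb (Q : Qmx) (i : 'I_T) (j : 'I_k) : R :=
  (alpha Q i j + gamma Q i j) / 2.

Definition f2 (Q : Qmx) (j : 'I_k) (theta : R) : R :=
  - \sum_(i < T) (rr Q i j * cos (2 * theta * t i - phi Q i j) + bb Q i j).

(* Curvature of a quadratic majorizer of f2 Q j touching it at theta. *)
Definition weight (Q : Qmx) (j : 'I_k) (theta : R) : R :=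
  \sum_(i < T) 4 * rr Q i j * t i ^+ 2 *
    sinc (wrap_angle (2 * theta * t i - phi Q i j)).

Variables lamQ lamTheta : R.

(* When the SVD is not unique, any choice of it is allowed. *)
Definition Q_update (Q : Qmx) (th : angles) (Q' : Qmx) : Prop :=
  exists W s V, is_svd (lamQ *: Q - nablaQ Q th) W s V /\ Q' = W *m V^T.

(* Q is the already updated iterate; the disequality says that the update is
   well defined. *)
Definition theta_update (Q : Qmx) (th th' : angles) : Prop :=
  forall j, weight Q j (th 0 j) + lamTheta != 0 /\
    th' 0 j =
      th 0 j - (weight Q j (th 0 j) + lamTheta)^-1 * derive1 (f2 Q j) (th 0 j).

Definition generated (u : nat -> Qmx * angles) : Prop :=
  stiefel (u 0%N).1 /\
  forall n, Q_update (u n).1 (u n).2 (u n.+1).1 /\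
            theta_update (u n.+1).1 (u n).2 (u n.+1).2.

Definition hitting_time (e : R) (u : nat -> Qmx * angles) : \bar R :=
  ereal_inf [set n%:R%:E | n in [set n | (1 <= n)%N /\ eps_stationary e (u n)]].

(* The supremum over initial points, and over all the runs from each of them. *)
Definition iter_complexity (e : R) : \bar R :=
  ereal_sup [set hitting_time e u | u in generated].

End Problem.

(* Main.v *)
Require Import Defs.
From mathcomp Require Import all_boot all_order all_algebra.
From mathcomp Require Import all_classical all_reals all_analysis.
From mathcomp Require Import ring lra.

(** The scheme alternates two minimizations of majorizers, so the objective
    decreases along a run; being bounded on the Stiefel manifold, its decrements
    are summable.  Everything rests on bounding the gradients by decrements with
    constants that depend on neither the run nor the iteration.

    For [Q], write [lamQ Q - nabla = Q' S], where [Q' = W V^T] and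
    [S = V diag(s) V^T] come from the singular value decomposition.  The
    objective is concave in [Q], and the linearization decreases by at least
    [tr ((Q' - Q) S (Q' - Q)^T) / 2].  Since [Q (lamQ - S)] is normal to the
    manifold, the squared norm of the Riemannian gradient at [Q] is at most that
    of [(Q' - Q) S], hence at most [tr S] times
    [tr ((Q' - Q) S (Q' - Q)^T)].  This is [Q_update_descent]; it holds even for
    [lamQ = 0], when [Q' - Q] need not tend to [0].

    For the angles, the objective at fixed [Q] is a sum of one-variable cosine
    sums ([objective_separates]), and [cos_quadratic_majorizer] gives the
    majorizer whose curvature is the weight.  A step of length [s] made with
    denominator [W] decreases the objective by at least [W s^2 / 2], and the
    slope after the step is [O(s)].  If [lamTheta > 0] then [W] is bounded below
    and the squared slope is [O(decrement)] ([step_slope_W]).  If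
    [lamTheta = 0] then [W] may degenerate, but, because
    [(1 + cos u) / 2 <= sin u / u], only near a maximizer of the cosine sum; as
    the step does not increase the function, it also ends near a maximizer,
    where the slope is small.  Together these give a fourth power of the slope
    that is [O(decrement)] ([step_slope4]).

    Both gradients therefore tend to [0] along every run, and their continuity
    makes all limit points stationary ([cluster_stationary]).  When
    [lamTheta > 0], telescoping the quadratic bounds over [N] iterations yields
    an iterate whose squared gradient norm is [O(1 / N)], whence the [e^-2]
    complexity, with no logarithmic factor ([hitting_time_le]). *)

Set Implicit Arguments.
Unset Strict Implicit.
Unset Printing Implicit Defensive.

Import Order.TTheory GRing.Theory Num.Theory.
Import numFieldNormedType.Exports.

Local Open Scope classical_set_scope.
Local Open Scope ring_scope.

(** * Trigonometric inequalities and the quadratic majorizer of the cosine *)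

Section Trigonometry.
Variable R : realType.
Implicit Types x y u v h a b : R.

Lemma is_derive_ge0_homo (f df : R -> R) a b : a <= b ->
  (forall x, is_derive x 1 f (df x)) ->
  (forall x, a <= x <= b -> 0 <= df x) -> f a <= f b.
Proof.
move=> ab fd df0.
have fc : {within `[a, b], continuous f}.
  apply: continuous_subspaceT => x.
  by apply: differentiable_continuous; apply/derivable1_diffP; case: (fd x).
have [c cab fE] := MVT_segment ab (fun x _ => fd x) fc.
by rewrite -subr_ge0 fE mulr_ge0 ?subr_ge0// df0// (itvP cab).
Qed.

Lemma sin_le x : 0 <= x -> sin x <= x.
Proof.
move=> x0; rewrite -subr_ge0.
have := @is_derive_ge0_homo (fun y => y - sin y) (fun y => 1 - cos y) 0 x x0.
rewrite sin0 subrr; apply=> y _.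
by rewrite subr_ge0 cos_le1.
Qed.

Lemma normr_sin_le x : `|sin x| <= `|x|.
Proof.
wlog x0 : x / 0 <= x.
  by case: (leP 0 x) => [x0 -> //|x0 /(_ (- x))]; rewrite sinN !normrN; apply; lra.
rewrite (ger0_norm x0); have [x1|x1] := leP 1 x.
  exact: le_trans (sin_max x) x1.
rewrite ger0_norm ?sin_le// sin_ge0_pi// x0/=.
by have := @pi_ge2 R; lra.
Qed.

Lemma sin_lipschitz x y : `|sin x - sin y| <= `|x - y|.
Proof.
have -> : sin x - sin y = 2 * cos ((x + y) / 2) * sin ((x - y) / 2).
  have := sinB ((x + y) / 2) ((x - y) / 2).
  have := sinD ((x + y) / 2) ((x - y) / 2).
  have -> : (x + y) / 2 + (x - y) / 2 = x by lra.
  have -> : (x + y) / 2 - (x - y) / 2 = y by lra.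
  by move=> -> ->; ring.
have -> : `|x - y| = 2 * `|(x - y) / 2|.
  by rewrite normrM [X in _ * (_ * X)]ger0_norm ?invr_ge0//; lra.
rewrite !normrM (ger0_norm (_ : 0 <= 2))// -mulrA ler_pM2l//.
have := normr_sin_le ((x - y) / 2); rewrite normrM.
have := cos_max ((x + y) / 2).
by move=> c1; apply: le_trans; rewrite ler_piMl.
Qed.

Lemma cos_ge_parabola x : 1 - x ^+ 2 / 2 <= cos x.
Proof.
have -> : cos x = 1 - 2 * sin (x / 2) ^+ 2.
  have -> : cos x = cos ((x / 2) *+ 2) by congr cos; lra.
  by rewrite cos_mulr2n cos2sin2; ring.
suff : sin (x / 2) ^+ 2 <= (x / 2) ^+ 2 by lra.
rewrite -[leLHS]real_normK ?num_real// -[leRHS]real_normK ?num_real//.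
by rewrite lerXn2r ?nnegrE// normr_sin_le.
Qed.

Lemma xcos_le_sin x : 0 <= x <= pi -> x * cos x <= sin x.
Proof.
case/andP=> x0 xpi; rewrite -subr_ge0.
have := @is_derive_ge0_homo (fun y => sin y - y * cos y) (fun y => y * sin y)
  0 x x0.
rewrite sin0 mul0r subrr; apply=> [y|y /andP[y0 yx]].
  apply: is_derive_eq; rewrite /GRing.scale/=; ring.
by rewrite mulr_ge0 ?sin_ge0_pi// y0 (le_trans yx).
Qed.

(** The graph of sine on [[0, pi]] lies above its chords from the origin. *)
Lemma sin_chord x y : 0 <= x -> x <= y -> y <= pi -> x * sin y <= y * sin x.
Proof.
move=> x0 xy ypi; rewrite -subr_ge0.
have := @is_derive_ge0_homo (fun z => z * sin x - x * sin z)
  (fun z => sin x - x * cos z) x y xy.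
rewrite subrr; apply=> [z|z /andP[xz zy]].
  by apply: is_derive_eq; rewrite /GRing.scale/=; ring.
rewrite subr_ge0; apply: le_trans (xcos_le_sin _).
  apply: ler_wpM2l => //; move: xz; rewrite le_eqVlt => /predU1P[->//|xz].
  by rewrite ltW// ltr_cos// in_itv/=; lra.
by lra.
Qed.

(** The difference of the two sides of [cos_majorant_le], cleared of its
    denominator, is decreasing before [u] and increasing after it: by
    [sin_chord], its derivative [2 (x sin u - u sin x)] has the sign of
    [x - u]. *)
Lemma cos_parabola_ge u x : 0 < u -> u <= pi -> 0 <= x -> x <= pi ->
  0 <= 2 * u * (cos x - cos u) + sin u * (x ^+ 2 - u ^+ 2).
Proof.
move=> u0 upi x0 xpi.
pose psi y := 2 * u * (cos y - cos u) + sin u * (y ^+ 2 - u ^+ 2).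
have psiu : psi u = 0 by rewrite /psi !subrr !mulr0 addr0.
have dpsi y : is_derive y 1 psi (2 * (y * sin u - u * sin y)).
  by rewrite /psi; apply: is_derive_eq; rewrite /GRing.scale/= ; ring.
have [xu|ux] := leP x u.
  rewrite -/(psi x) -psiu -lerN2.
  apply: (@is_derive_ge0_homo (fun y => - psi y)
    (fun y => - (2 * (y * sin u - u * sin y)))) => // y /andP[xy yu].
  by have := @sin_chord y u (le_trans x0 xy) yu upi; lra.
rewrite -/(psi x) -psiu; apply: is_derive_ge0_homo dpsi _; first exact: ltW.
move=> y /andP[uy yx].
by have := @sin_chord u y (ltW u0) uy (le_trans yx xpi); lra.
Qed.

Lemma sincM u : sinc u * u = sin u.
Proof.
by rewrite /sinc; case: eqP => [->|/eqP u0]; rewrite ?sin0 ?mulr0// divfK.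
Qed.

Lemma sincN u : sinc (- u) = sinc u.
Proof. by rewrite /sinc oppr_eq0 sinN invrN mulrNN. Qed.

(** The tangent parabola of [- cos] at [u] is even, so that it also touches at
    [- u], and it stays above [- cos].  The point [y] is folded back into
    [[0, pi]] by [acos \o cos], which preserves the cosine and does not increase
    the absolute value. *)
Lemma cos_majorant_le u y : - pi <= u <= pi ->
  0 <= cos y - cos u + sinc u / 2 * (y ^+ 2 - u ^+ 2).
Proof.
wlog u0 : u / 0 <= u.
  case: (leP 0 u) => [u0 + ?|u0 /(_ (- u))]; first exact.
  rewrite sincN cosN sqrrN => + ?; apply; lra.
case/andP=> _ upi.
have [->|u_neq0] := eqVneq u 0.
  rewrite /sinc eqxx cos0; have := cos_ge_parabola y; lra.
have u_gt0 : 0 < u by rewrite lt_def u_neq0.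
have cy : -1 <= cos y <= 1 by rewrite cos_geN1 cos_le1.
pose x := acos (cos y).
have x0 : 0 <= x by exact: acos_ge0.
have xpi : x <= pi by exact: acos_lepi.
have cx : cos x = cos y by rewrite /x acosK// in_itv.
have xy : x ^+ 2 <= y ^+ 2.
  rewrite -[leRHS]real_normK ?num_real// lerXn2r// ?nnegrE//.
  have [ypi|ypi] := leP `|y| pi; last exact: le_trans xpi (ltW ypi).
  by rewrite /x -cos_norm cosK// in_itv/= normr_ge0.
have su : 0 <= sin u by rewrite sin_ge0_pi ?u0.
have sc0 : 0 <= sinc u by rewrite /sinc gt_eqF// divr_ge0.
have := cos_parabola_ge u_gt0 upi x0 xpi.
rewrite -sincM cx => h.
have {}h : 0 <= 2 * u * (cos y - cos u + sinc u / 2 * (x ^+ 2 - u ^+ 2)) by lra.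
rewrite pmulr_rge0 in h; last by rewrite mulr_gt0.
apply: le_trans h _; rewrite lerD2l ler_wpM2l ?divr_ge0//; lra.
Qed.

(** In terms of [v = u / 2] this is [v <= tan v].  It makes the weights control
    the distance of a cosine sum to its maximum, see
    [maxgap_le_curvature]. *)
Lemma sinc_ge_cos u : - pi <= u <= pi -> (1 + cos u) / 2 <= sinc u.
Proof.
wlog u0 : u / 0 <= u.
  case: (leP 0 u) => [u0 + ?|u0 /(_ (- u))]; first exact.
  by rewrite sincN cosN => + ?; apply; lra.
case/andP=> _ upi.
rewrite /sinc; case: eqP => [->|/eqP u_neq0]; first by rewrite cos0; lra.
rewrite ler_pdivlMr ?lt_def ?u_neq0//.
have uE : u = (u / 2) *+ 2 by lra.
rewrite uE sin_mulr2n cos_mulr2n -uE.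
have : 0 <= cos (u / 2) * (sin (u / 2) - u / 2 * cos (u / 2)).
  apply: mulr_ge0; first by apply: cos_ge0_pihalf; lra.
  by rewrite subr_ge0 xcos_le_sin//; lra.
lra.
Qed.

Lemma sinc_le1 u : sinc u <= 1.
Proof.
wlog u0 : u / 0 <= u.
  by case: (leP 0 u) => [u0 + //|u0 /(_ (- u))]; [exact|rewrite sincN; apply; lra].
rewrite /sinc; case: eqP => // /eqP u_neq0.
by rewrite ler_pdivrMr ?lt_def ?u_neq0// mul1r sin_le.
Qed.

Lemma wrap_angleE x : exists n : int, wrap_angle x = x - pi *+ 2 *~ n.
Proof.
exists (Num.floor ((x + pi) / (2 * pi))); rewrite /wrap_angle; congr (x - _).
by rewrite mulr_natl mulrzr.
Qed.

Lemma periodic_int (f : R -> R) (p : R) (n : int) x :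
  periodic f p -> f (x - p *~ n) = f x.
Proof.
move=> fp; case: n => n.
  by rewrite -[LHS](periodicn fp n) subrK.
by rewrite NegzE mulrNz opprK (periodicn fp).
Qed.

Lemma cos_wrap x : cos (wrap_angle x) = cos x.
Proof. by have [n ->] := wrap_angleE x; exact/periodic_int/cosD2pi. Qed.

Lemma sin_wrap x : sin (wrap_angle x) = sin x.
Proof. by have [n ->] := wrap_angleE x; exact/periodic_int/sinD2pi. Qed.

Lemma wrap_angle_itv x : - pi <= wrap_angle x <= pi.
Proof.
have pi2 : 0 < 2 * pi :> R by rewrite mulr_gt0 ?pi_gt0.
have /andP[] := mem_rg1_floor ((x + pi) / (2 * pi)).
set m : R := _%:~R => /(ler_wpM2l (ltW pi2)) lo.
rewrite /wrap_angle -/m -(ltr_pM2l pi2).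
move: lo; rewrite mulrCA divff ?gt_eqF// mulr1 => lo hi; lra.
Qed.

Lemma sinc_wrap_ge0 x : 0 <= sinc (wrap_angle x).
Proof.
apply: le_trans (sinc_ge_cos (wrap_angle_itv x)).
by have := cos_geN1 (wrap_angle x); lra.
Qed.

Lemma cos_quadratic_majorizer x h :
  - cos (x + h) <= - cos x + sin x * h + sinc (wrap_angle x) / 2 * h ^+ 2.
Proof.
set u := wrap_angle x.
have -> : cos (x + h) = cos (u + h).
  have [n uE] := wrap_angleE x; rewrite /u uE addrAC.
  by rewrite (periodic_int _ _ (@cosD2pi R)).
rewrite -(cos_wrap x) -(sin_wrap x) -/u -sincM.
by have := cos_majorant_le (u + h) (wrap_angle_itv x); rewrite -/u; lra.
Qed.

Lemma atan_polar a b : a != 0 ->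
  Num.sqrt (a ^+ 2 + b ^+ 2) * cos (atan (b / a)) = `|a| /\
  Num.sqrt (a ^+ 2 + b ^+ 2) * sin (atan (b / a)) = `|a| * (b / a).
Proof.
move=> a0; have c0 : cos (atan (b / a)) != 0.
  by rewrite gt_eqF// cos_gt0_pihalf// atan_gtNpi2 atan_ltpi2.
have cE : Num.sqrt (a ^+ 2 + b ^+ 2) * cos (atan (b / a)) = `|a|.
  have -> : a ^+ 2 + b ^+ 2 = a ^+ 2 * (1 + (b / a) ^+ 2) by field.
  rewrite cos_atan sqrtrM ?sqr_ge0// sqrtr_sqr mulfK//.
  by rewrite gt_eqF// sqrtr_gt0 ltr_pwDl// sqr_ge0.
split=> //; rewrite -cE -mulrA; congr (_ * _).
transitivity (cos (atan (b / a)) * tan (atan (b / a))); last by rewrite atanK.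
by rewrite /tan mulrCA divff ?mulr1.
Qed.

Lemma atan2_polar a b : let r := Num.sqrt (a ^+ 2 + b ^+ 2) in
  r * cos (atan2 b a) = a /\ r * sin (atan2 b a) = b.
Proof.
rewrite /= /atan2; have [a0|a0|->] := ltgtP a 0.
- have [c s] := atan_polar b (ltr0_neq0 a0).
  rewrite ltr0_norm// in c s.
  case: ifP => _; rewrite ?cosDpi ?sinDpi ?mulrN ?c ?s.
    by split; [ring|field; rewrite ltr0_neq0].
  have cB x : cos (x - pi) = - cos x by rewrite -[in RHS](subrK pi x) cosDpi opprK.
  have sB x : sin (x - pi) = - sin x by rewrite -[in RHS](subrK pi x) sinDpi opprK.
  rewrite cB sB !mulrN c s.
  by split; [ring|field; rewrite ltr0_neq0].
- have [c s] := atan_polar b (lt0r_neq0 a0).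
  rewrite c s gtr0_norm//; split=> //; field; exact: lt0r_neq0.
- rewrite expr0n add0r sqrtr_sqr.
  have [b0|b0|->] := ltgtP b 0.
  + by rewrite cosN sinN cos_pihalf sin_pihalf ltr0_norm//; split; ring.
  + by rewrite cos_pihalf sin_pihalf gtr0_norm//; split; ring.
  + by rewrite normr0 !mul0r.
Qed.

End Trigonometry.

(** * Cosine sums in one variable *)

Section RealSums.
Variable R : realType.

Lemma sum_CauchySchwarz (I : finType) (x y : I -> R) :
  (\sum_i x i * y i) ^+ 2 <= (\sum_i x i ^+ 2) * (\sum_i y i ^+ 2).
Proof.
have h : 0 <= \sum_i \sum_j (x i * y j - x j * y i) ^+ 2.
  by apply: sumr_ge0 => i _; apply: sumr_ge0 => j _; exact: sqr_ge0.
have e (f g : I -> R) : (\sum_i f i) * (\sum_i g i) = \sum_i \sum_j f i * g j.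
  by rewrite mulr_suml; apply: eq_bigr => i _; rewrite mulr_sumr.
have : \sum_i \sum_j (x i * y j - x j * y i) ^+ 2 =
  (\sum_i x i ^+ 2) * (\sum_i y i ^+ 2) + (\sum_i y i ^+ 2) * (\sum_i x i ^+ 2)
  - 2 * ((\sum_i x i * y i) * (\sum_i x i * y i)).
  rewrite !e mulr_sumr -big_split/= -sumrB; apply: eq_bigr => i _.
  rewrite mulr_sumr -big_split/= -sumrB; apply: eq_bigr => j _; ring.
rewrite -expr2 => h'; move: h; rewrite h' => {}h.
lra.
Qed.

Lemma sqr_sum_le (I : finType) (x : I -> R) :
  (\sum_i x i) ^+ 2 <= #|I|%:R * \sum_i x i ^+ 2.
Proof.
have := sum_CauchySchwarz x (fun=> 1).
rewrite (eq_bigr x) => [/le_trans|i _]; last by rewrite mulr1.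
by apply; rewrite mulrC (eq_bigr (fun=> 1)) ?sumr_const// => i _; rewrite expr1n.
Qed.

Lemma ler_sum_term (I : finType) (x : I -> R) i :
  (forall j, 0 <= x j) -> x i <= \sum_j x j.
Proof. by move=> x0; rewrite (bigD1 i)//= lerDl sumr_ge0. Qed.

End RealSums.

Section CosineSums.
Variables (R : realType) (T : nat) (r t p b : 'I_T -> R).
Hypotheses (r0 : forall i, 0 <= r i) (ht : forall i, 0 <= t i <= 1).
Implicit Types x y : R.

Definition cossum (x : R) : R :=
  - \sum_(i < T) (r i * cos (2 * x * t i - p i) + b i).

Definition cossum' (x : R) : R :=
  \sum_(i < T) 2 * r i * t i * sin (2 * x * t i - p i).

Definition curvature (x : R) : R :=
  \sum_(i < T) 4 * r i * t i ^+ 2 * sinc (wrap_angle (2 * x * t i - p i)).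

(** How far the oscillating part of [cossum] is below the sum of the maxima of
    its terms.  The terms with [t i = 0] are constant: they are left out since
    no weight controls them. *)
Definition maxgap (x : R) : R :=
  \sum_(i < T | 0 < t i) r i * (1 + cos (2 * x * t i - p i)).

Lemma is_derive_cossum x : is_derive x 1 cossum (cossum' x).
Proof.
have -> : cossum = - \sum_(i < T) (fun x => r i * cos (2 * x * t i - p i) + b i).
  by apply/funext => y; rewrite /cossum fctE fct_sumE.
have -> : cossum' x = - \sum_(i < T) - (2 * r i * t i * sin (2 * x * t i - p i)).
  by rewrite sumrN opprK.
apply: is_deriveN; apply: is_derive_sum => i.
by apply: is_derive_eq; rewrite /GRing.scale/=; ring.
Qed.

Lemma derive1_cossum x : derive1 cossum x = cossum' x.
Proof.
by rewrite derive1E; exact: (@derive_val _ _ _ _ _ _ _ (is_derive_cossum x)).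
Qed.

Lemma cossum_majorizer x y :
  cossum y <= cossum x + cossum' x * (y - x) + curvature x / 2 * (y - x) ^+ 2.
Proof.
rewrite /cossum /cossum' /curvature !mulr_suml -!sumrN -!big_split/=.
apply: ler_sum => i _.
have := cos_quadratic_majorizer (2 * x * t i - p i) (2 * t i * (y - x)).
have -> : 2 * x * t i - p i + 2 * t i * (y - x) = 2 * y * t i - p i by ring.
by move=> /(ler_wpM2l (r0 i)); lra.
Qed.

Lemma cossum'_lipschitz x y :
  `|cossum' x - cossum' y| <= 4 * (\sum_i r i) * `|x - y|.
Proof.
rewrite -sumrB -mulrA mulr_suml mulr_sumr.
apply: le_trans (ler_norm_sum _ _ _) (ler_sum _ _) => i _.
have [t0 t1] := andP (ht i).
rewrite -mulrBr normrM ger0_norm ?mulr_ge0//.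
have := sin_lipschitz (2 * x * t i - p i) (2 * y * t i - p i).
have -> : 2 * x * t i - p i - (2 * y * t i - p i) = 2 * t i * (x - y) by ring.
rewrite normrM (ger0_norm (_ : 0 <= 2 * t i)) ?mulr_ge0// => s.
apply: (@le_trans _ _ (2 * r i * t i * (2 * t i * `|x - y|))).
  by rewrite ler_wpM2l ?mulr_ge0.
have : t i * t i * (r i * `|x - y|) <= 1 * (r i * `|x - y|).
  by rewrite ler_wpM2r ?mulr_ge0//; nra.
lra.
Qed.

Lemma cossum'_le x : `|cossum' x| <= 2 * \sum_i r i.
Proof.
rewrite mulr_sumr; apply: le_trans (ler_norm_sum _ _ _) (ler_sum _ _) => i _.
have [t0 t1] := andP (ht i).
rewrite normrM ger0_norm ?mulr_ge0//.
have : t i * `|sin (2 * x * t i - p i)| <= 1 * 1 by rewrite ler_pM// sin_max.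
by move=> /(ler_wpM2l (r0 i)); lra.
Qed.

Lemma curvature_ge0 x : 0 <= curvature x.
Proof.
apply: sumr_ge0 => i _.
by rewrite mulr_ge0 ?sinc_wrap_ge0// mulr_ge0 ?sqr_ge0// mulr_ge0.
Qed.

Lemma curvature_le x : curvature x <= 4 * \sum_i r i.
Proof.
rewrite mulr_sumr; apply: ler_sum => i _.
have [t0 t1] := andP (ht i).
have : t i ^+ 2 * sinc (wrap_angle (2 * x * t i - p i)) <= 1 * 1.
  by rewrite ler_pM ?sqr_ge0 ?sinc_wrap_ge0 ?sinc_le1// expr_le1.
by move=> /(ler_wpM2l (r0 i)); lra.
Qed.

Lemma maxgapB x y : maxgap y - maxgap x = cossum x - cossum y.
Proof.
rewrite /maxgap /cossum -!sumrN -!big_split/= big_mkcond/=.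
apply: eq_bigr => i _; case: ifPn => [_|]; first ring.
rewrite -leNgt => t0; have -> : t i = 0.
  by apply/eqP; rewrite eq_le t0; case/andP: (ht i).
by rewrite !mulr0; ring.
Qed.

Lemma maxgap_ge0 x : 0 <= maxgap x.
Proof.
apply: sumr_ge0 => i _; exact: mulr_ge0.
Qed.

(** Near its maximum a cosine has a small derivative:
    [sin^2 = (1 - cos) (1 + cos) <= 2 (1 + cos)]. *)
Lemma cossum'_sqr_le x :
  cossum' x ^+ 2 <= 8 * T%:R * (\sum_i r i) * maxgap x.
Proof.
have S0 : 0 <= \sum_i r i by exact: sumr_ge0.
apply: le_trans (sqr_sum_le _) _; rewrite card_ord.
have -> : 8 * T%:R * (\sum_i r i) * maxgap x =
  T%:R * (8 * (\sum_i r i) * maxgap x) by ring.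
rewrite ler_wpM2l ?ler0n// /maxgap mulr_sumr [leRHS]big_mkcond/=.
apply: ler_sum => i _.
have [t0 t1] := andP (ht i); set u := _ - _.
case: ifPn => [_|]; last first.
  rewrite -leNgt => t0'; have -> : t i = 0 by apply/eqP; rewrite eq_le t0'.
  by rewrite mulr0 mul0r expr0n.
have rS : r i <= \sum_i r i by exact: ler_sum_term.
have c1 := cos_geN1 u; have c2 := cos_le1 u.
have : r i * (r i * (t i ^+ 2 * sin u ^+ 2)) <=
       (\sum_i r i) * (r i * (2 * (1 + cos u))).
  apply: ler_pM => //; first by apply: mulr_ge0 => //; rewrite mulr_ge0 ?sqr_ge0.
  apply: ler_wpM2l => //; apply: (@le_trans _ _ (1 * sin u ^+ 2)).
    by rewrite ler_wpM2r ?sqr_ge0// expr_le1.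
  by rewrite sin2cos2; nra.
lra.
Qed.

Lemma maxgap_le_curvature x :
  maxgap x <= (\sum_i t i ^- 2) * curvature x / 2.
Proof.
rewrite /maxgap /curvature big_mkcond/= mulr_sumr mulr_suml.
apply: ler_sum => i _; set u := _ - _.
have [t0 t1] := andP (ht i); case: ifPn => [ti|_]; last first.
  rewrite !mulr_ge0 ?invr_ge0 ?sqr_ge0 ?sinc_wrap_ge0//.
  by apply: sumr_ge0 => j _; rewrite invr_ge0 sqr_ge0.
have h := sinc_ge_cos (wrap_angle_itv u); rewrite cos_wrap in h.
have c1 := cos_geN1 u.
have tS : t i ^- 2 <= \sum_i t i ^- 2.
  by apply: ler_sum_term => j; rewrite invr_ge0 sqr_ge0.
have : (t i ^- 2 * t i ^+ 2) * (r i * ((1 + cos u) / 2)) <=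
    ((\sum_i t i ^- 2) * t i ^+ 2) * (r i * sinc (wrap_angle u)).
  apply: ler_pM.
  - by rewrite mulr_ge0 ?invr_ge0 ?sqr_ge0.
  - by rewrite mulr_ge0// divr_ge0//; lra.
  - by rewrite ler_wpM2r ?sqr_ge0.
  - by rewrite ler_wpM2l.
rewrite mulVf ?sqrf_eq0 ?gt_eqF//; lra.
Qed.

(** One step of the majorization scheme from [x] to [y], with a bound [S] on the
    amplitudes that is kept separate from their sum, so that the constants do
    not depend on the iterate. *)
Section Step.
Variables (lam S x y : R).
Hypotheses (lam0 : 0 <= lam) (rS : \sum_i r i <= S)
  (W0 : curvature x + lam != 0)
  (yE : y = x - (curvature x + lam)^-1 * cossum' x).

Let W := curvature x + lam.

Let W_gt0 : 0 < W.
Proof. by rewrite lt_def W0 addr_ge0 ?curvature_ge0. Qed.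

Let slopeE : cossum' x = W * (x - y).
Proof. by rewrite yE opprB addrC subrK mulrA divff ?mul1r. Qed.

Lemma step_descent : W / 2 * (x - y) ^+ 2 <= cossum x - cossum y.
Proof.
have := cossum_majorizer x y; rewrite slopeE.
have : 0 <= lam / 2 * (x - y) ^+ 2 by rewrite mulr_ge0 ?divr_ge0 ?sqr_ge0.
rewrite /W; lra.
Qed.

Lemma step_descent_ge0 : 0 <= cossum x - cossum y.
Proof.
apply: le_trans step_descent.
by rewrite mulr_ge0 ?sqr_ge0// divr_ge0// ltW.
Qed.

(** The slope after the step is at most the slope [W (x - y)] before it plus its
    variation, so it is [O(|x - y|)], while the decrement is at least
    [W (x - y)^2 / 2]. *)
Lemma step_slope_W :
  W * cossum' y ^+ 2 <= 2 * (8 * S + lam) ^+ 2 * (cossum x - cossum y).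
Proof.
have W_ge0 := ltW W_gt0.
have Sr : 0 <= \sum_i r i by exact: sumr_ge0.
have S0 : 0 <= S := le_trans Sr rS.
have WS : W <= 4 * S + lam.
  by rewrite lerD2r (le_trans (curvature_le x))// ler_wpM2l.
have h : `|cossum' y| <= (8 * S + lam) * `|x - y|.
  have -> : cossum' y = cossum' x - (cossum' x - cossum' y) by ring.
  apply: le_trans (ler_normB _ _) _.
  have := cossum'_lipschitz x y.
  rewrite slopeE normrM (ger0_norm W_ge0).
  have : W * `|x - y| <= (4 * S + lam) * `|x - y| by rewrite ler_wpM2r.
  have : 4 * (\sum_i r i) * `|x - y| <= 4 * S * `|x - y|.
    by rewrite ler_wpM2r// ler_wpM2l.
  lra.
have {}h : cossum' y ^+ 2 <= (8 * S + lam) ^+ 2 * (x - y) ^+ 2.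
  rewrite -exprMn -[leLHS]real_normK ?num_real// -[leRHS]real_normK ?num_real//.
  rewrite lerXn2r ?nnegrE// normrM [X in X * _]ger0_norm//.
  by rewrite addr_ge0// mulr_ge0.
have /(ler_wpM2l (sqr_ge0 (8 * S + lam))) := step_descent.
have /(ler_wpM2l W_ge0) := h.
lra.
Qed.

(** When [W] is small the current angle is close to a maximizer, hence so is
    the next one since the objective only decreases; the slope there is then
    small as well.  When [W] is not small [step_slope_W] applies.  Multiplying
    both bounds makes [W] disappear. *)
Lemma step_slope4 : cossum' y ^+ 4 <=
  8 * T%:R * S * ((\sum_i t i ^- 2) * (8 * S + lam) ^+ 2 + 4 * S ^+ 2)
  * (cossum x - cossum y).
Proof.
have d0 := step_descent_ge0.
have Sr : 0 <= \sum_i r i by exact: sumr_ge0.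
have S0 : 0 <= S := le_trans Sr rS.
have K0 : 0 <= \sum_i t i ^- 2.
  by apply: sumr_ge0 => i _; rewrite invr_ge0 sqr_ge0.
have h1 := step_slope_W.
set g2 := cossum' y ^+ 2 in h1 *.
have -> : cossum' y ^+ 4 = g2 * g2 by rewrite -expr2 -exprM.
set d := _ - _ in d0 h1 *; set K := \sum_i t i ^- 2 in K0 *.
have g20 : 0 <= g2 by exact: sqr_ge0.
have g2S : g2 <= 4 * S ^+ 2.
  have -> : 4 * S ^+ 2 = (2 * S) ^+ 2 by ring.
  rewrite /g2 -[leLHS]real_normK ?num_real// lerXn2r ?nnegrE// ?mulr_ge0//.
  by apply: le_trans (cossum'_le y) _; rewrite ler_wpM2l.
have gap : maxgap y <= K * W / 2 + d.
  rewrite -[maxgap y](subrK (maxgap x)) maxgapB addrC lerD2r.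
  apply: le_trans (maxgap_le_curvature x) _.
  by rewrite ler_wpM2r ?invr_ge0// ler_wpM2l// lerDl.
have h2 : g2 <= 8 * T%:R * S * (K * W / 2 + d).
  apply: le_trans (cossum'_sqr_le y) _.
  have := maxgap_ge0 y.
  by move=> m0; rewrite ler_pM ?mulr_ge0 ?ler0n// ler_wpM2l// mulr_ge0// ler0n.
set A := 8 * T%:R * S in h2 *.
have A0 : 0 <= A by rewrite !mulr_ge0 ?ler0n.
apply: le_trans (ler_wpM2r g20 h2) _.
have /(ler_wpM2l (mulr_ge0 A0 K0)) := h1.
have /(ler_wpM2l (mulr_ge0 A0 d0)) := g2S.
lra.
Qed.

End Step.
End CosineSums.

(** * Frobenius inner product and tangent projection on the Stiefel manifold *)

Section Frobenius.
Variable R : realType.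

Lemma frob_dotE m n (A B : 'M[R]_(m, n)) :
  frob_dot A B = \sum_j \sum_i A i j * B i j.
Proof.
by apply: eq_bigr => j _; rewrite mxE; apply: eq_bigr => i _; rewrite mxE.
Qed.

Lemma frob_dotC m n (A B : 'M[R]_(m, n)) : frob_dot A B = frob_dot B A.
Proof. by rewrite /frob_dot -mxtrace_tr trmx_mul trmxK. Qed.

Lemma frob_dotDr m n (A B C : 'M[R]_(m, n)) :
  frob_dot A (B + C) = frob_dot A B + frob_dot A C.
Proof. by rewrite /frob_dot mulmxDr raddfD. Qed.

Lemma frob_dotNr m n (A B : 'M[R]_(m, n)) : frob_dot A (- B) = - frob_dot A B.
Proof. by rewrite /frob_dot mulmxN raddfN. Qed.

Lemma frob_dotZr m n (A B : 'M[R]_(m, n)) a :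
  frob_dot A (a *: B) = a * frob_dot A B.
Proof. by rewrite /frob_dot -scalemxAr mxtraceZ. Qed.

Lemma frob_dotDl m n (A B C : 'M[R]_(m, n)) :
  frob_dot (A + B) C = frob_dot A C + frob_dot B C.
Proof. by rewrite !(frob_dotC _ C) frob_dotDr. Qed.

Lemma frob_dotNl m n (A B : 'M[R]_(m, n)) : frob_dot (- A) B = - frob_dot A B.
Proof. by rewrite !(frob_dotC _ B) frob_dotNr. Qed.

Lemma frob_dotZl m n (A B : 'M[R]_(m, n)) a :
  frob_dot (a *: A) B = a * frob_dot A B.
Proof. by rewrite !(frob_dotC _ B) frob_dotZr. Qed.

Lemma frob_dot_suml m n (I : finType) (F : I -> 'M[R]_(m, n)) B :
  frob_dot (\sum_i F i) B = \sum_i frob_dot (F i) B.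
Proof. by rewrite /frob_dot raddf_sum mulmx_suml raddf_sum. Qed.

Lemma frob_dot_ge0 m n (A : 'M[R]_(m, n)) : 0 <= frob_dot A A.
Proof.
rewrite frob_dotE; apply: sumr_ge0 => j _; apply: sumr_ge0 => i _.
by rewrite -expr2 sqr_ge0.
Qed.

Lemma sqr_frob_norm m n (A : 'M[R]_(m, n)) : frob_norm A ^+ 2 = frob_dot A A.
Proof. by rewrite sqr_sqrtr// frob_dot_ge0. Qed.

Lemma frob_norm_ge0 m n (A : 'M[R]_(m, n)) : 0 <= frob_norm A.
Proof. exact: sqrtr_ge0. Qed.

Lemma frob_dot_mull m n q (A : 'M[R]_(m, q)) (B : 'M[R]_(q, n)) (C : 'M[R]_(m, n)) :
  frob_dot (A *m B) C = frob_dot B (A^T *m C).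
Proof. by rewrite /frob_dot trmx_mul mulmxA. Qed.

Lemma frob_dot_mulr m n q (A : 'M[R]_(m, q)) (B : 'M[R]_(q, n)) (C : 'M[R]_(m, n)) :
  frob_dot (A *m B) C = frob_dot A (C *m B^T).
Proof. by rewrite /frob_dot trmx_mul -mulmxA mxtrace_mulC mulmxA. Qed.

Lemma frob_dot_tr m n (A B : 'M[R]_(m, n)) : frob_dot A^T B^T = frob_dot A B.
Proof. by rewrite frob_dotC /frob_dot trmxK mxtrace_mulC. Qed.

Lemma frob_dot_le m n (A B : 'M[R]_(m, n)) :
  2 * frob_dot A B <= frob_dot A A + frob_dot B B.
Proof.
have := frob_dot_ge0 (A - B).
by rewrite !(frob_dotDl, frob_dotDr, frob_dotNl, frob_dotNr) (frob_dotC B A); lra.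
Qed.

Lemma frob_mulmx_le m n q (A : 'M[R]_(m, q)) (B : 'M[R]_(q, n)) :
  frob_dot (A *m B) (A *m B) <= frob_dot A A * frob_dot B B.
Proof.
rewrite -(frob_dot_tr A A) !frob_dotE mulr_sumr; apply: ler_sum => j _.
rewrite mulr_suml; apply: ler_sum => i _.
rewrite mxE -expr2; apply: le_trans (sum_CauchySchwarz _ _) _.
under eq_bigr do rewrite expr2.
under [X in _ * X <= _]eq_bigr do rewrite expr2.
rewrite le_eqVlt; apply/orP; left; apply/eqP.
by congr (_ * _); apply: eq_bigr => l _; rewrite mxE.
Qed.

Lemma frob_dot_mul_diag m n (A B : 'M[R]_(m, n)) (s : 'rV[R]_n) :
  frob_dot (A *m diag_mx s) B = \sum_j \sum_i A i j * s 0 j * B i j.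
Proof.
by rewrite frob_dotE mul_mx_diag; under eq_bigr do under eq_bigr do rewrite mxE.
Qed.

Lemma stiefel_frob d p (Q : 'M[R]_(d, p)) : stiefel Q -> frob_dot Q Q = p%:R.
Proof. by rewrite /stiefel/= /frob_dot => ->; rewrite mxtrace1. Qed.

End Frobenius.

Section TangentSpace.
Variables (R : realType) (d p : nat).
Implicit Types (Q A E : 'M[R]_(d, p)) (K : 'M[R]_p).

(** The orthogonal projection onto the tangent space at [Q]: the normal space
    consists of the [Q *m K] with [K] symmetric. *)
Definition tangent_proj Q A : 'M[R]_(d, p) :=
  A - Q *m (2^-1 *: (Q^T *m A + A^T *m Q)).

Lemma tangent_projB Q A E :
  tangent_proj Q (A - E) = tangent_proj Q A - tangent_proj Q E.
Proof.
rewrite /tangent_proj.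
have -> : Q^T *m (A - E) + (A - E)^T *m Q =
    (Q^T *m A + A^T *m Q) - (Q^T *m E + E^T *m Q).
  by rewrite mulmxBr raddfB/= mulmxBl opprD addrACA.
rewrite scalerBr mulmxBr !opprB -!addrA; congr (_ + _).
by rewrite addrC -addrA addrCA.
Qed.

Lemma frob_dot_normal_tangent Q K E :
  K^T = K -> stiefel_tangent Q E -> frob_dot (Q *m K) E = 0.
Proof.
rewrite /stiefel_tangent/= => KT QE.
rewrite frob_dot_mull.
have : frob_dot K (Q^T *m E + E^T *m Q) = 0 by rewrite QE /frob_dot mulmx0 mxtrace0.
have <- : (Q^T *m E)^T = E^T *m Q by rewrite trmx_mul trmxK.
rewrite frob_dotDr -[frob_dot K _^T]frob_dot_tr trmxK KT; lra.
Qed.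

Lemma tangent_proj_sym Q A : (2^-1 *: (Q^T *m A + A^T *m Q))^T =
  2^-1 *: (Q^T *m A + A^T *m Q).
Proof. by rewrite linearZ/= linearD/= !trmx_mul !trmxK addrC. Qed.

Lemma tangent_projP Q A : stiefel Q ->
  stiefel_tangent Q (tangent_proj Q A).
Proof.
rewrite /stiefel_tangent /stiefel/= => QQ; rewrite /tangent_proj.
have := tangent_proj_sym Q A; set K := _ *: _ => KT.
rewrite mulmxBr raddfB/= mulmxBl trmx_mul KT -!mulmxA QQ mulmx1 mulmxA QQ mul1mx.
rewrite addrACA -opprD /K -scalerDl.
have -> : 2^-1 + 2^-1 = 1 :> R by lra.
by rewrite scale1r subrr.
Qed.

Lemma frob_dot_tangent_proj Q A E : stiefel_tangent Q E ->
  frob_dot (tangent_proj Q A) E = frob_dot A E.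
Proof.
move=> QE; rewrite /tangent_proj frob_dotDl frob_dotNl.
by rewrite frob_dot_normal_tangent ?subr0// tangent_proj_sym.
Qed.

Lemma tangent_proj_contract Q A : stiefel Q ->
  frob_dot (tangent_proj Q A) (tangent_proj Q A) <= frob_dot A A.
Proof.
move=> QQ; have := frob_dot_tangent_proj A (tangent_projP A QQ).
have := frob_dot_le A (tangent_proj Q A).
by move=> + h; rewrite -h; lra.
Qed.

Lemma tangent_proj_normal Q K : stiefel Q -> K^T = K ->
  tangent_proj Q (Q *m K) = 0.
Proof.
rewrite /stiefel/= /tangent_proj => QQ KT.
have -> : Q^T *m (Q *m K) + (Q *m K)^T *m Q = 2 *: K.
  by rewrite trmx_mul KT mulmxA QQ mul1mx -mulmxA QQ mulmx1 scaler_nat mulr2n.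
by rewrite scalerA mulVf ?scale1r ?subrr// pnatr_eq0.
Qed.

End TangentSpace.

(** * The objective as a function of the Stiefel matrix *)

Section Objective.
Variables (R : realType) (d l k T : nat).
Variables (X : 'I_T -> 'M[R]_(d, l)) (t : 'I_T -> R).
Implicit Types (Q E : 'M[R]_(d, k + k)) (th : 'rV[R]_k).

Lemma objectiveE Q th : objective X t Q th =
  - \sum_i frob_dot ((X i)^T *m Q *m Zmat t th i) ((X i)^T *m Q *m Zmat t th i).
Proof. by congr (- _); apply: eq_bigr => i _; rewrite sqr_frob_norm. Qed.

Lemma objective_le0 Q th : objective X t Q th <= 0.
Proof.
by rewrite objectiveE oppr_le0; apply: sumr_ge0 => i _; exact: frob_dot_ge0.
Qed.

Lemma frob_dot_nablaQ Q E th : frob_dot (nablaQ X t Q th) E =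
  - 2 * \sum_i frob_dot ((X i)^T *m Q *m Zmat t th i) ((X i)^T *m E *m Zmat t th i).
Proof.
rewrite /nablaQ frob_dotZl frob_dot_suml; congr (_ * _); apply: eq_bigr => i _.
by rewrite frob_dot_mulr trmxK -!mulmxA frob_dot_mull !mulmxA.
Qed.

(** The objective is a quadratic form in [Q].  With [objective_le0] this
    expansion says that it is concave, so that its linearization majorizes
    it. *)
Lemma objectiveD Q E th : objective X t (Q + E) th =
  objective X t Q th + frob_dot (nablaQ X t Q th) E + objective X t E th.
Proof.
rewrite frob_dot_nablaQ !objectiveE mulr_sumr -!sumrN -!big_split/=.
apply: eq_bigr => i _; rewrite !(mulmxDl, mulmxDr) !(frob_dotDl, frob_dotDr).
by rewrite (frob_dotC (_ *m E *m _) (_ *m Q *m _)); ring.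
Qed.

Lemma objectiveZ a E th : objective X t (a *: E) th = a ^+ 2 * objective X t E th.
Proof.
rewrite !objectiveE mulrN mulr_sumr; congr (- _); apply: eq_bigr => i _.
by rewrite -!(scalemxAl, scalemxAr) frob_dotZl frob_dotZr mulrA.
Qed.

Lemma derive_objectiveQ Q E th :
  'D_E (fun Q' => objective X t Q' th) Q = frob_dot (nablaQ X t Q th) E.
Proof.
set D := frob_dot _ _; set c := objective X t E th.
have h : (fun h : R => D + h * c) @ 0^' --> D.
  have : (fun h : R => D + h * c) @ (0 : R) --> D + 0 * c.
    by apply: cvgD; [exact: cvg_cst|apply: cvgM; [exact: cvg_id|exact: cvg_cst]].
  by rewrite mul0r addr0; apply: cvg_trans; apply: cvg_app; exact: cvg_within.
rewrite /derive; apply/cvg_lim => //.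
apply: cvg_trans h; apply: near_eq_cvg.
near=> h; rewrite /= (addrC _ Q) objectiveD objectiveZ frob_dotZr -/c -/D.
have h0 : h != 0 by near: h; exact: nbhs_dnbhs_neq.
rewrite /GRing.scale/=; field.
Unshelve. all: by end_near. Qed.

Lemma riemannian_grad_tangent_proj Q th : stiefel Q ->
  is_riemannian_gradQ X t Q th (tangent_proj Q (nablaQ X t Q th)).
Proof.
move=> QQ; split; first exact: tangent_projP.
by move=> E QE; rewrite frob_dot_tangent_proj// derive_objectiveQ.
Qed.

Definition energy_bound : R :=
  \sum_i frob_dot (X i) (X i) * (k + k)%:R * k%:R.

Lemma frob_Zmat th i : frob_dot (Zmat t th i) (Zmat t th i) = k%:R.
Proof.
rewrite frob_dotE -[k in RHS]card_ord -sumr_const; apply: eq_bigr => j _.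
rewrite big_split_ord/= (bigD1 j)//= big1 => [|i' /negbTE ij]; last first.
  by rewrite col_mxEu !mxE ij mul0r.
rewrite [X in _ + X](bigD1 j)//= big1 => [|i' /negbTE ij]; last first.
  by rewrite col_mxEd !mxE ij mul0r.
by rewrite col_mxEu col_mxEd !mxE eqxx !mulr1n !addr0 -!expr2 cos2Dsin2.
Qed.

Lemma objective_ge Q th : stiefel Q -> - energy_bound <= objective X t Q th.
Proof.
move=> QQ; rewrite objectiveE lerN2; apply: ler_sum => i _.
apply: le_trans (frob_mulmx_le _ _) _; rewrite frob_Zmat ler_wpM2r ?ler0n//.
by apply: le_trans (frob_mulmx_le _ _) _; rewrite frob_dot_tr (stiefel_frob QQ).
Qed.

Section QStep.
Variables (lamQ : R) (Q Q' : 'M[R]_(d, k + k)) (th : 'rV[R]_k).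
Hypotheses (lamQ0 : 0 <= lamQ) (QQ : stiefel Q) (upd : Q_update X t lamQ Q th Q').

(** A bound on [tr S], the sum of the singular values: it equals
    [<lamQ Q - nabla, Q'>], whose second part is a polarized energy. *)
Definition singular_bound : R := lamQ * (k + k)%:R + 2 * energy_bound.

Lemma Q_update_stiefel : stiefel Q'.
Proof.
have [W [s [V [[WW VV _ _] ->]]]] := upd.
rewrite /stiefel/= trmx_mul trmxK -mulmxA (mulmxA W^T) WW mul1mx.
exact: mulmx1C.
Qed.

(** With [S = V diag(s) V^T], the matrix [lamQ Q - nabla] equals [Q' S], so that
    [nabla = Q (lamQ - S) - (Q' - Q) S]: the first term is normal, hence the
    Riemannian gradient is bounded by [(Q' - Q) S].  On the other hand
    minimizing the linearization makes the objective decrease by at least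
    [tr ((Q' - Q) S (Q' - Q)^T) / 2], which controls the former even when
    [lamQ] is zero and the steps need not vanish. *)
Lemma Q_update_descent : let G := tangent_proj Q (nablaQ X t Q th) in
  frob_dot G G <=
    2 * singular_bound * (objective X t Q th - objective X t Q' th) /\
  0 <= objective X t Q th - objective X t Q' th.
Proof.
have Q'Q' := Q_update_stiefel.
have [W [s [V [[WW VV s0 ME] Q'E]]]] := upd.
set N := nablaQ X t Q th in ME *.
set delta := _ - _; move=> G.
have VV' : V *m V^T = 1%:M by exact: mulmx1C.
pose S := V *m diag_mx s *m V^T; pose D := Q' - Q; pose A := D *m V.
have ST : S^T = S by rewrite /S !trmx_mul trmxK tr_diag_mx mulmxA.
have MS : lamQ *: Q - N = Q' *m S.
  by rewrite ME Q'E /S !mulmxA -(mulmxA W V^T V) VV mulmx1.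
have NE : N = Q *m (lamQ%:M - S) - D *m S.
  rewrite mulmxBr mul_mx_scalar mulmxBl opprB addrA subrK -MS opprB addrC.
  by rewrite subrK.
have GE : frob_dot G G <= frob_dot (D *m S) (D *m S).
  rewrite /G NE tangent_projB tangent_proj_normal// ?sub0r; last first.
    by rewrite linearB/= tr_scalar_mx ST.
  by rewrite frob_dotNl frob_dotNr opprK tangent_proj_contract.
pose tau := \sum_j \sum_i A i j ^+ 2 * s 0 j.
have sS j : s 0 j <= \sum_j s 0 j by exact: ler_sum_term.
have DS : frob_dot (D *m S) (D *m S) <= (\sum_j s 0 j) * tau.
  have -> : D *m S = A *m diag_mx s *m V^T by rewrite /S /A !mulmxA.
  rewrite frob_dot_mulr trmxK -mulmxA VV mulmx1 frob_dot_mul_diag.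
  rewrite mulr_sumr; apply: ler_sum => j _; rewrite mulr_sumr.
  apply: ler_sum => i _; rewrite mul_mx_diag [X in _ * X]mxE.
  have : s 0 j * (A i j ^+ 2 * s 0 j) <= (\sum_j s 0 j) * (A i j ^+ 2 * s 0 j).
    by rewrite ler_wpM2r// mulr_ge0// sqr_ge0.
  lra.
have trS : \sum_j s 0 j = frob_dot (lamQ *: Q - N) Q'.
  by rewrite MS frob_dotC /frob_dot mulmxA Q'Q' mul1mx /S mxtrace_mulC mulmxA VV
             mul1mx mxtrace_diag.
have tauE : tau = 2 * frob_dot (lamQ *: Q - N) D.
  have -> : tau = frob_dot (A *m diag_mx s) A.
    rewrite frob_dot_mul_diag; apply: eq_bigr => j _; apply: eq_bigr => i _.
    by ring.
  have -> : frob_dot (A *m diag_mx s) A = frob_dot S (D^T *m D).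
    rewrite frob_dotC /A frob_dot_mulr -!mulmxA frob_dotC frob_dot_mull.
    by rewrite /S mulmxA.
  have -> : D^T *m D = (1%:M - Q'^T *m Q) + (1%:M - Q'^T *m Q)^T.
    have -> : (1%:M - Q'^T *m Q)^T = 1%:M - Q^T *m Q'.
      by rewrite raddfB/= trmx1 trmx_mul trmxK.
    have -> : D^T = Q'^T - Q^T by rewrite /D raddfB.
    rewrite mulmxBl !mulmxBr QQ Q'Q'.
    by rewrite opprB.
  rewrite frob_dotDr -[frob_dot S _^T]frob_dot_tr trmxK ST.
  by rewrite MS frob_dot_mull mulmxBr Q'Q'; ring.
have dE : tau / 2 + lamQ / 2 * frob_dot D D <= delta.
  rewrite /delta -[Q'](subrKC Q) -/D objectiveD -/N.
  have := objective_le0 D th.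
  have DD : frob_dot Q D = - frob_dot D D / 2.
    rewrite /D !(frob_dotDl, frob_dotDr, frob_dotNl, frob_dotNr) (frob_dotC Q' Q).
    by rewrite !stiefel_frob//; field.
  rewrite tauE frob_dotDl frob_dotNl frob_dotZl DD; lra.
have tau0 : 0 <= tau.
  apply: sumr_ge0 => j _; apply: sumr_ge0 => i _.
  by rewrite mulr_ge0 ?sqr_ge0.
have DD0 : 0 <= lamQ / 2 * frob_dot D D.
  by rewrite mulr_ge0 ?frob_dot_ge0 ?divr_ge0.
have tau_delta : tau <= 2 * delta by lra.
have S0 : 0 <= \sum_j s 0 j by exact: sumr_ge0.
have SB : \sum_j s 0 j <= singular_bound.
  rewrite trS frob_dotDl frob_dotNl frob_dotZl /singular_bound.
  have := frob_dot_le Q Q'; rewrite !stiefel_frob// => q.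
  have {q} /(ler_wpM2l lamQ0) : frob_dot Q Q' <= (k + k)%:R by lra.
  have : - frob_dot N Q' <= - objective X t Q th - objective X t Q' th.
    rewrite frob_dot_nablaQ !objectiveE !opprK mulr_sumr -sumrN -big_split/=.
    apply: ler_sum => i _.
    have := frob_dot_le ((X i)^T *m Q *m Zmat t th i) ((X i)^T *m Q' *m Zmat t th i).
    lra.
  have := objective_ge th QQ; have := objective_ge th Q'Q'.
  lra.
split; last lra.
apply: le_trans GE _; apply: le_trans DS _.
have : (\sum_j s 0 j) * tau <= singular_bound * (2 * delta) by rewrite ler_pM.
lra.
Qed.

End QStep.
End Objective.

(** * The objective as a function of the angles *)

Section Angles.
Variables (R : realType) (d l k T : nat).
Variables (X : 'I_T -> 'M[R]_(d, l)) (t : 'I_T -> R).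
Implicit Types (Q : 'M[R]_(d, k + k)) (th : 'rV[R]_k).

Local Notation XH Q i := ((X i)^T *m lsubmx Q).
Local Notation XY Q i := ((X i)^T *m rsubmx Q).

Lemma alphaE Q i j : alpha X Q i j = \sum_a XH Q i a j ^+ 2.
Proof.
rewrite /alpha -[_^T *m X i]trmxK trmx_mul trmxK -mulmxA mxE.
by apply: eq_bigr => a _; rewrite [_^T _ _]mxE expr2.
Qed.

Lemma betaE Q i j : beta X Q i j = \sum_a XH Q i a j * XY Q i a j.
Proof.
rewrite /beta -[_^T *m X i]trmxK trmx_mul trmxK -mulmxA mxE.
by apply: eq_bigr => a _; rewrite [_^T _ _]mxE mulrC.
Qed.

Lemma gammaE Q i j : gamma X Q i j = \sum_a XY Q i a j ^+ 2.
Proof.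
rewrite /gamma -[_^T *m X i]trmxK trmx_mul trmxK -mulmxA mxE.
by apply: eq_bigr => a _; rewrite [_^T _ _]mxE expr2.
Qed.

Lemma rr_ge0 Q i j : 0 <= rr X Q i j.
Proof. exact: sqrtr_ge0. Qed.

Lemma rr_cos Q i j x : rr X Q i j * cos (x - phi X Q i j) =
  (alpha X Q i j - gamma X Q i j) / 2 * cos x + beta X Q i j * sin x.
Proof.
have [c s] := atan2_polar ((alpha X Q i j - gamma X Q i j) / 2) (beta X Q i j).
rewrite -/(rr X Q i j) -/(phi X Q i j) in c s.
by rewrite cosB -{}c -{}s; ring.
Qed.

(** The polar angle jumps at the negative axis and at the origin; the right-hand
    side is visibly continuous in [Q], whence [nablaTheta_continuous]. *)
Lemma rr_sin Q i j x : rr X Q i j * sin (x - phi X Q i j) =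
  (alpha X Q i j - gamma X Q i j) / 2 * sin x - beta X Q i j * cos x.
Proof.
have [c s] := atan2_polar ((alpha X Q i j - gamma X Q i j) / 2) (beta X Q i j).
rewrite -/(rr X Q i j) -/(phi X Q i j) in c s.
by rewrite sinB -{}c -{}s; ring.
Qed.

(** By Cauchy-Schwarz [beta^2 <= alpha gamma].  As [bb] averages two entries of
    an energy, this bounds the amplitudes uniformly on the Stiefel manifold. *)
Lemma rr_le_bb Q i j : rr X Q i j <= bb X Q i j.
Proof.
have a0 : 0 <= alpha X Q i j.
  by rewrite alphaE; apply: sumr_ge0 => a _; exact: sqr_ge0.
have g0 : 0 <= gamma X Q i j.
  by rewrite gammaE; apply: sumr_ge0 => a _; exact: sqr_ge0.
have CS : beta X Q i j ^+ 2 <= alpha X Q i j * gamma X Q i j.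
  by rewrite alphaE betaE gammaE; exact: sum_CauchySchwarz.
rewrite /rr /bb -[leRHS]ger0_norm ?divr_ge0 ?addr_ge0// -sqrtr_sqr.
rewrite ler_wsqrtr//; lra.
Qed.

Definition radius_bound : R := \sum_i frob_dot (X i) (X i) * k%:R.

Lemma sum_rr_le Q j : stiefel Q -> \sum_i rr X Q i j <= radius_bound.
Proof.
move=> QQ; apply: ler_sum => i _; apply: le_trans (rr_le_bb Q i j) _.
have : alpha X Q i j + gamma X Q i j <=
    frob_dot ((X i)^T *m Q) ((X i)^T *m Q).
  rewrite -[Q in leRHS]hsubmxK mul_mx_row frob_dotE big_split_ord/=.
  rewrite alphaE gammaE; apply: lerD.
    rewrite (bigD1 j)//= [leLHS](eq_bigr (fun a => XH Q i a j * XH Q i a j))//.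
    rewrite [X in _ <= X + _](eq_bigr (fun a => XH Q i a j * XH Q i a j)).
      rewrite lerDl; apply: sumr_ge0 => j' _; apply: sumr_ge0 => a _.
      by rewrite -expr2 sqr_ge0.
    by move=> a _; rewrite !row_mxEl.
  rewrite (bigD1 j)//= [leLHS](eq_bigr (fun a => XY Q i a j * XY Q i a j))//.
  rewrite [X in _ <= X + _](eq_bigr (fun a => XY Q i a j * XY Q i a j)).
    rewrite lerDl; apply: sumr_ge0 => j' _; apply: sumr_ge0 => a _.
    by rewrite -expr2 sqr_ge0.
  by move=> a _; rewrite !row_mxEr.
have := frob_mulmx_le (X i)^T Q; rewrite frob_dot_tr (stiefel_frob QQ) natrD /bb.
lra.
Qed.

Lemma objective_separates Q th :
  objective X t Q th = \sum_j f2 X t Q j (th 0 j).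
Proof.
rewrite objectiveE /f2 sumrN [in RHS]exchange_big/=.
congr (- _); apply: eq_bigr => i _.
rewrite -[in LHS](hsubmxK Q) mul_mx_row mul_row_col !mul_mx_diag frob_dotE.
apply: eq_bigr => j _.
set th2 := 2 * th 0 j * t i.
have th2E : th2 = (th 0 j * t i) *+ 2 by rewrite /th2; ring.
rewrite rr_cos /bb th2E cos_mulr2n sin_mulr2n.
set c := cos _; set s := sin _.
have sE : s ^+ 2 = 1 - c ^+ 2 by rewrite sin2cos2.
have -> : (alpha X Q i j - gamma X Q i j) / 2 * (c ^+ 2 *+ 2 - 1) +
    beta X Q i j * (c * s *+ 2) + (alpha X Q i j + gamma X Q i j) / 2 =
    alpha X Q i j * c ^+ 2 + 2 * beta X Q i j * (c * s)
    + gamma X Q i j * s ^+ 2 by rewrite sE; field.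
rewrite alphaE betaE gammaE mulr_sumr !mulr_suml -!big_split/=.
apply: eq_bigr => a _; rewrite !mxE -/c -/s; ring.
Qed.

Lemma f2E Q j : f2 X t Q j =
  cossum (fun i => rr X Q i j) t (fun i => phi X Q i j) (fun i => bb X Q i j).
Proof. by []. Qed.

Lemma nablaThetaE Q th j : nablaTheta X t Q th 0 j =
  cossum' (fun i => rr X Q i j) t (fun i => phi X Q i j) (th 0 j).
Proof.
rewrite mxE -(derive1_cossum _ _ _ (fun i => bb X Q i j)) -f2E /derive /derive1.
set F := (fun h : R => _); set G := (fun h : R => _).
suff -> : F = G by [].
apply/funext => h; rewrite {}/F {}/G; congr (_ *: _) => /=.
rewrite !objective_separates -sumrB (bigD1 j)//= big1 ?addr0 => [|j' jj'].
  by rewrite !mxE !eqxx mulr1.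
by rewrite !mxE eqxx/= (negbTE jj') mulr0 add0r subrr.
Qed.

Section ThetaStep.
Variables (lamTheta : R) (Q : 'M[R]_(d, k + k)) (th th' : 'rV[R]_k).
Hypotheses (ht : forall i, 0 <= t i <= 1) (lam0 : 0 <= lamTheta)
  (QQ : stiefel Q) (upd : theta_update X t lamTheta Q th th').

Definition slope4_bound : R :=
  8 * T%:R * radius_bound *
    ((\sum_i t i ^- 2) * (8 * radius_bound + lamTheta) ^+ 2 +
     4 * radius_bound ^+ 2).

Definition slope2_bound : R := 2 * (8 * radius_bound + lamTheta) ^+ 2.

Lemma theta_update_term j :
  [/\ 0 <= f2 X t Q j (th 0 j) - f2 X t Q j (th' 0 j),
      nablaTheta X t Q th' 0 j ^+ 4 <=
        slope4_bound * (f2 X t Q j (th 0 j) - f2 X t Q j (th' 0 j)) &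
      lamTheta * nablaTheta X t Q th' 0 j ^+ 2 <=
        slope2_bound * (f2 X t Q j (th 0 j) - f2 X t Q j (th' 0 j))].
Proof.
have [W0 yE] := upd j; rewrite f2E derive1_cossum in yE.
have r0 i := rr_ge0 Q i j.
have rS := sum_rr_le j QQ.
rewrite !f2E !nablaThetaE; split.
- exact: step_descent_ge0 yE.
- exact: step_slope4 yE.
- apply: le_trans (step_slope_W _ r0 ht lam0 rS W0 yE).
  by rewrite ler_wpM2r ?sqr_ge0// lerDr curvature_ge0.
Qed.

Lemma theta_update_descent :
  0 <= objective X t Q th - objective X t Q th' /\
  (forall j, nablaTheta X t Q th' 0 j ^+ 4 <=
    slope4_bound * (objective X t Q th - objective X t Q th')) /\
  lamTheta * frob_dot (nablaTheta X t Q th') (nablaTheta X t Q th') <=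
    slope2_bound * (objective X t Q th - objective X t Q th').
Proof.
rewrite !objective_separates -sumrB; split; [|split].
- by apply: sumr_ge0 => j _; case: (theta_update_term j).
- move=> j; case: (theta_update_term j) => _ + _ => /le_trans; apply.
  apply: ler_wpM2l; last first.
    by apply: ler_sum_term => j'; case: (theta_update_term j').
  have rb : 0 <= radius_bound.
    by apply: sumr_ge0 => i _; rewrite mulr_ge0 ?frob_dot_ge0 ?ler0n.
  have K0 : 0 <= \sum_i t i ^- 2.
    by apply: sumr_ge0 => i _; rewrite invr_ge0 sqr_ge0.
  rewrite /slope4_bound mulr_ge0// ?mulr_ge0 ?ler0n//.
  by rewrite addr_ge0// mulr_ge0 ?sqr_ge0.
- rewrite frob_dotE !mulr_sumr; apply: ler_sum => j _.
  by rewrite big_ord1 -expr2; case: (theta_update_term j).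
Qed.

End ThetaStep.
End Angles.

(** * Limit points and iteration complexity *)

Section EntrywiseContinuity.
Variables (R : realType) (U : topologicalType) (p : U).

Lemma continuous_sum_at (I : finType) (F : I -> U -> R) :
  (forall i, {for p, continuous (F i)}) ->
  {for p, continuous (fun x => \sum_i F i x)}.
Proof.
move=> cF; rewrite /index_enum; elim: (locked_with _ _) => [|i s IH].
  rewrite (_ : (fun _ => _) = fun=> 0); last by apply/funext => x; rewrite big_nil.
  exact: cvg_cst.
rewrite (_ : (fun _ => _) = (fun x => F i x + \sum_(j <- s) F j x)).
  by apply: cvgD; [exact: cF|exact: IH].
by apply/funext => x; rewrite big_cons.
Qed.

(** Unlike continuity for the topology of matrices, this gives continuity of
    products of rectangular matrices directly from that of sums. *)
Definition entries_continuous m n (F : U -> 'M[R]_(m, n)) :=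
  forall i j, {for p, continuous (fun x => F x i j)}.

Lemma entries_continuous_cst m n (A : 'M[R]_(m, n)) :
  entries_continuous (fun=> A).
Proof. by move=> i j; exact: cvg_cst. Qed.

Lemma entries_continuousD m n (F G : U -> 'M[R]_(m, n)) :
  entries_continuous F -> entries_continuous G ->
  entries_continuous (fun x => F x + G x).
Proof.
move=> cF cG i j; rewrite (_ : (fun _ => _) = fun x => F x i j + G x i j).
  by apply: cvgD; [exact: cF|exact: cG].
by apply/funext => x; rewrite mxE.
Qed.

Lemma entries_continuousZ m n a (F : U -> 'M[R]_(m, n)) :
  entries_continuous F -> entries_continuous (fun x => a *: F x).
Proof.
move=> cF i j; rewrite (_ : (fun _ => _) = fun x => a * F x i j).
  by apply: cvgM; [exact: cvg_cst|exact: cF].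
by apply/funext => x; rewrite mxE.
Qed.

Lemma entries_continuousB m n (F G : U -> 'M[R]_(m, n)) :
  entries_continuous F -> entries_continuous G ->
  entries_continuous (fun x => F x - G x).
Proof.
move=> cF cG; under [fun _ => _]funext do rewrite -[X in _ + X]scaleN1r.
by apply: entries_continuousD => //; exact: entries_continuousZ.
Qed.

Lemma entries_continuous_tr m n (F : U -> 'M[R]_(m, n)) :
  entries_continuous F -> entries_continuous (fun x => (F x)^T).
Proof.
move=> cF i j; rewrite (_ : (fun _ => _) = fun x => F x j i); first exact: cF.
by apply/funext => x; rewrite mxE.
Qed.

Lemma entries_continuousM m n q (F : U -> 'M[R]_(m, q)) (G : U -> 'M[R]_(q, n)) :
  entries_continuous F -> entries_continuous G ->
  entries_continuous (fun x => F x *m G x).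
Proof.
move=> cF cG i j.
rewrite (_ : (fun _ => _) = fun x => \sum_a F x i a * G x a j).
  by apply: continuous_sum_at => a; apply: cvgM; [exact: cF|exact: cG].
by apply/funext => x; rewrite mxE.
Qed.

Lemma entries_continuous_sum m n (I : finType) (F : I -> U -> 'M[R]_(m, n)) :
  (forall i, entries_continuous (F i)) ->
  entries_continuous (fun x => \sum_i F i x).
Proof.
move=> cF i j; rewrite (_ : (fun _ => _) = fun x => \sum_a F a x i j).
  by apply: continuous_sum_at => a; exact: cF.
by apply/funext => x; rewrite summxE.
Qed.

Lemma entries_continuous_diag n (F : U -> 'rV[R]_n) :
  entries_continuous F -> entries_continuous (fun x => diag_mx (F x)).
Proof.
move=> cF i j; rewrite (_ : (fun _ => _) = fun x => F x 0 i *+ (i == j)).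
  by case: (i == j); rewrite /= ?mulr1n; [exact: cF|exact: cvg_cst].
by apply/funext => x; rewrite !mxE.
Qed.

Lemma entries_continuous_col m1 m2 n (F : U -> 'M[R]_(m1, n))
    (G : U -> 'M[R]_(m2, n)) :
  entries_continuous F -> entries_continuous G ->
  entries_continuous (fun x => col_mx (F x) (G x)).
Proof.
move=> cF cG i j; rewrite -(splitK i); case: (fintype.split i) => i' /=.
  rewrite (_ : (fun _ => _) = fun x => F x i' j); first exact: cF.
  by apply/funext => x; rewrite col_mxEu.
rewrite (_ : (fun _ => _) = fun x => G x i' j); first exact: cG.
by apply/funext => x; rewrite col_mxEd.
Qed.

Lemma frob_dot_continuous m n (F G : U -> 'M[R]_(m, n)) :
  entries_continuous F -> entries_continuous G ->
  {for p, continuous (fun x => frob_dot (F x) (G x))}.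
Proof.
move=> cF cG; have -> : (fun x => frob_dot (F x) (G x)) =
    fun x => \sum_j \sum_i F x i j * G x i j.
  by apply/funext => x; rewrite frob_dotE.
apply: continuous_sum_at => j; apply: continuous_sum_at => i.
by apply: cvgM; [exact: cF|exact: cG].
Qed.

(** The shift by one in the last hypothesis is there because a bound on the
    gradient in the angles is available only after a first update. *)
Lemma cluster_eq0 (u : nat -> U) (phi : U -> R) (v : nat -> R) :
  cluster (u @ \oo) p -> {for p, continuous phi} -> v @ \oo --> 0 ->
  (forall n, `|phi (u n.+1)| <= v n) -> phi p = 0.
Proof.
move=> clu cphi v0 phiv; apply/eqP/negP => /negP; rewrite -normr_gt0 => e0.
have e20 : 0 < `|phi p| / 2 by rewrite divr_gt0.
have near_p : nbhs p [set x | `|phi p - phi x| < `|phi p| / 2].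
  by move/cvgrPdist_lt: cphi => /(_ _ e20).
have near_u : (u @ \oo) [set x | `|phi x| < `|phi p| / 2].
  move/cvgrPdist_lt: v0 => /(_ _ e20) [N _ vN].
  exists N.+1 => // -[//|n] /= Nn.
  apply: le_lt_trans (phiv n) _; apply: le_lt_trans (ler_norm _) _.
  by have := vN n Nn; rewrite /= sub0r normrN.
have [x [/= ux px]] := clu _ _ near_u near_p.
have := ler_normD (phi p - phi x) (phi x); rewrite subrK; lra.
Qed.

End EntrywiseContinuity.

Section Convergence.
Variables (R : realType) (d l k T : nat).
Variables (X : 'I_T -> 'M[R]_(d, l)) (t : 'I_T -> R).
Local Notation pt := ('M[R]_(d, k + k) * 'rV[R]_k)%type.

Definition gradQ (x : pt) := tangent_proj x.1 (nablaQ X t x.1 x.2).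

Lemma entries_continuous_fst (x0 : pt) : entries_continuous x0 (fun x : pt => x.1).
Proof.
move=> i j; apply: (@cvg_comp _ _ _ fst (fun M : 'M[R]_(d, k + k) => M i j)).
  exact: cvg_fst.
exact: coord_continuous.
Qed.

Lemma entries_continuous_snd (x0 : pt) : entries_continuous x0 (fun x : pt => x.2).
Proof.
move=> i j; apply: (@cvg_comp _ _ _ snd (fun M : 'rV[R]_k => M i j)).
  exact: cvg_snd.
exact: coord_continuous.
Qed.

Lemma entries_continuous_gradQ (x0 : pt) : entries_continuous x0 gradQ.
Proof.
have cQ := @entries_continuous_fst x0; have cth := @entries_continuous_snd x0.
have cZ i : entries_continuous x0 (fun x : pt => Zmat t x.2 i).
  apply: entries_continuous_col; apply: entries_continuous_diag => a j.
    rewrite (_ : (fun _ => _) = fun x : pt => cos (x.2 0 j * t i)).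
      apply: (@cvg_comp _ _ _ (fun x : pt => x.2 0 j * t i) cos).
        by apply: cvgM; [exact: cth|exact: cvg_cst].
      exact: continuous_cos.
    by apply/funext => x; rewrite mxE.
  rewrite (_ : (fun _ => _) = fun x : pt => sin (x.2 0 j * t i)).
    apply: (@cvg_comp _ _ _ (fun x : pt => x.2 0 j * t i) sin).
      by apply: cvgM; [exact: cth|exact: cvg_cst].
    exact: continuous_sin.
  by apply/funext => x; rewrite mxE.
have cN : entries_continuous x0 (fun x : pt => nablaQ X t x.1 x.2).
  apply: entries_continuousZ; apply: entries_continuous_sum => i.
  do 2?apply: entries_continuousM; last exact: entries_continuous_tr.
    apply: entries_continuousM => //; exact: entries_continuous_cst.
  exact: cZ.
apply: entries_continuousB => //; apply: entries_continuousM => //.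
apply: entries_continuousZ; apply: entries_continuousD;
  apply: entries_continuousM => //; exact: entries_continuous_tr.
Qed.

Lemma nablaTheta_continuous (x0 : pt) j :
  {for x0, continuous (fun x : pt => nablaTheta X t x.1 x.2 0 j)}.
Proof.
have cQ := @entries_continuous_fst x0; have cth := @entries_continuous_snd x0.
have cX m (F : pt -> 'M[R]_(d, m)) i : entries_continuous x0 F ->
    entries_continuous x0 (fun x => (X i)^T *m F x).
  by move=> ?; apply: entries_continuousM => //; exact: entries_continuous_cst.
have cH : entries_continuous x0 (fun x : pt => lsubmx x.1).
  move=> i a; rewrite (_ : (fun _ => _) = fun x : pt => x.1 i (lshift k a)).
    exact: cQ.
  by apply/funext => x; rewrite mxE.
have cY : entries_continuous x0 (fun x : pt => rsubmx x.1).
  move=> i a; rewrite (_ : (fun _ => _) = fun x : pt => x.1 i (rshift k a)).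
    exact: cQ.
  by apply/funext => x; rewrite mxE.
have ca i : {for x0, continuous (fun x : pt => alpha X x.1 i j)}.
  have -> : (fun x : pt => alpha X x.1 i j) =
      fun x : pt => \sum_a ((X i)^T *m lsubmx x.1) a j ^+ 2.
    by apply/funext => x; rewrite alphaE.
  by apply: continuous_sum_at => a; apply: cvgM; exact: cX.
have cb i : {for x0, continuous (fun x : pt => beta X x.1 i j)}.
  have -> : (fun x : pt => beta X x.1 i j) =
      fun x : pt => \sum_a ((X i)^T *m lsubmx x.1) a j
        * ((X i)^T *m rsubmx x.1) a j.
    by apply/funext => x; rewrite betaE.
  by apply: continuous_sum_at => a; apply: cvgM; exact: cX.
have cg i : {for x0, continuous (fun x : pt => gamma X x.1 i j)}.
  have -> : (fun x : pt => gamma X x.1 i j) =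
      fun x : pt => \sum_a ((X i)^T *m rsubmx x.1) a j ^+ 2.
    by apply/funext => x; rewrite gammaE.
  by apply: continuous_sum_at => a; apply: cvgM; exact: cX.
have carg i : {for x0, continuous (fun x : pt => 2 * x.2 0 j * t i)}.
  by apply: cvgM; [apply: cvgM; [exact: cvg_cst|exact: cth]|exact: cvg_cst].
rewrite (_ : (fun _ => _) = fun x : pt => \sum_i 2 * t i *
  ((alpha X x.1 i j - gamma X x.1 i j) / 2 * sin (2 * x.2 0 j * t i) -
   beta X x.1 i j * cos (2 * x.2 0 j * t i))); last first.
  apply/funext => x; rewrite nablaThetaE; apply: eq_bigr => i _.
  by rewrite -rr_sin; ring.
apply: continuous_sum_at => i; apply: cvgM; first exact: cvg_cst.
apply: cvgB; apply: cvgM.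
- by apply: cvgM; [apply: cvgB; [exact: ca|exact: cg]|exact: cvg_cst].
- by apply: cvg_comp (carg i) _; exact: continuous_sin.
- exact: cb.
- by apply: cvg_comp (carg i) _; exact: continuous_cos.
Qed.

Variables (lamQ lamTheta : R).
Hypotheses (ht : forall i, 0 <= t i <= 1) (lamQ0 : 0 <= lamQ)
  (lamTheta0 : 0 <= lamTheta).

Section Run.
Variables (u : nat -> pt) (gen : generated X t lamQ lamTheta u).

Local Notation f n := (objective X t (u n).1 (u n).2).
Local Notation gradTheta n := (nablaTheta X t (u n).1 (u n).2).
Local Notation CQ := (2 * singular_bound k X lamQ).
Local Notation C4 := (slope4_bound k X t lamTheta).
Local Notation C2 := (slope2_bound k X lamTheta).

Lemma generated_stiefel n : stiefel (u n).1.
Proof.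
case: gen => u0 step; elim: n => [//|n IH].
exact: Q_update_stiefel (step n).1.
Qed.

Lemma bounds_ge0 : [/\ 0 <= CQ, 0 <= C4 & 0 <= C2].
Proof.
have eb : 0 <= energy_bound k X.
  by apply: sumr_ge0 => i _; rewrite !mulr_ge0 ?frob_dot_ge0 ?ler0n.
have rb : 0 <= radius_bound k X.
  by apply: sumr_ge0 => i _; rewrite mulr_ge0 ?frob_dot_ge0 ?ler0n.
have K0 : 0 <= \sum_i t i ^- 2.
  by apply: sumr_ge0 => i _; rewrite invr_ge0 sqr_ge0.
split.
- by rewrite mulr_ge0// addr_ge0 ?mulr_ge0 ?ler0n.
- rewrite /slope4_bound mulr_ge0// ?mulr_ge0 ?ler0n//.
  by rewrite addr_ge0// mulr_ge0 ?sqr_ge0.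
- by rewrite /slope2_bound mulr_ge0 ?sqr_ge0.
Qed.

(** The gradients are taken at different times: the one in [Q] is controlled by
    the step that leaves the iterate, the one in the angles by the step that
    reaches it, since the angles are updated at the new [Q]. *)
Lemma generated_descent n :
  [/\ f n.+1 <= f n,
      frob_dot (gradQ (u n)) (gradQ (u n)) <= CQ * (f n - f n.+1),
      forall j, gradTheta n.+1 0 j ^+ 4 <= C4 * (f n - f n.+1) &
      lamTheta * frob_dot (gradTheta n.+1) (gradTheta n.+1) <=
        C2 * (f n - f n.+1)].
Proof.
have [updQ updT] := gen.2 n.
have [hQ dQ] := Q_update_descent lamQ0 (generated_stiefel n) updQ.
have [dT [hT4 hT2]] :=
  theta_update_descent ht lamTheta0 (generated_stiefel n.+1) updT.
have [CQ0 C40 C20] := bounds_ge0.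
move: dQ dT hQ hT4 hT2.
move: (f n) (objective X t (u n.+1).1 (u n).2) (f n.+1) => a b c.
move=> ab bc hQ hT4 hT2; split; first lra.
- by apply: le_trans hQ _; apply: ler_wpM2l => //; lra.
- by move=> j; apply: le_trans (hT4 j) _; apply: ler_wpM2l => //; lra.
- by apply: le_trans hT2 _; apply: ler_wpM2l => //; lra.
Qed.

Lemma objective_decrement_cvg0 c : (fun n => c * (f n - f n.+1)) @ \oo --> 0.
Proof.
have cf : cvgn (fun n => f n).
  apply: nonincreasing_is_cvgn.
    by apply/nonincreasing_seqP => n; case: (generated_descent n).
  exists (- energy_bound k X) => _ [n _ <-].
  exact/objective_ge/generated_stiefel.
rewrite -(mulr0 c) -(subrr (limn (fun n => f n))).
apply: cvgM; first exact: cvg_cst.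
by apply: cvgB => //; rewrite (cvg_shiftS (fun n => f n)).
Qed.

Lemma cluster_stationary p : cluster (u @ \oo) p -> stationary X t p.
Proof.
move=> clu; have cQ := @entries_continuous_fst p.
have Qp : stiefel p.1.
  rewrite /stiefel/=; apply/matrixP => i j; apply/eqP; rewrite -subr_eq0; apply/eqP.
  pose phi (x : pt) := (x.1^T *m x.1 - 1%:M) i j.
  have -> : (p.1^T *m p.1) i j - 1%:M i j = phi p by rewrite /phi !mxE.
  apply: (@cluster_eq0 _ _ p u phi (fun=> 0)) => //.
  - apply: entries_continuousB; last exact: entries_continuous_cst.
    by apply: entries_continuousM => //; exact: entries_continuous_tr.
  - exact: cvg_cst.
  - by move=> n; rewrite /phi (generated_stiefel n.+1) subrr mxE normr0.
have Gp : frob_dot (gradQ p) (gradQ p) = 0.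
  apply: (@cluster_eq0 _ _ p u (fun x => frob_dot (gradQ x) (gradQ x)) _ clu).
  - exact: frob_dot_continuous (@entries_continuous_gradQ p)
      (@entries_continuous_gradQ p).
  - have := objective_decrement_cvg0 CQ.
    rewrite -(cvg_shiftS (fun n => CQ * (f n - f n.+1))); apply.
  - move=> n; rewrite ger0_norm ?frob_dot_ge0//.
    by case: (generated_descent n.+1).
have Tp : nablaTheta X t p.1 p.2 = 0.
  apply/rowP => j; rewrite [RHS]mxE.
  have cT : {for p, continuous (fun x : pt => nablaTheta X t x.1 x.2 0 j ^+ 4)}.
    have cT := @nablaTheta_continuous p j.
    by do 3!apply: cvgM => //.
  apply/eqP; have : nablaTheta X t p.1 p.2 0 j ^+ 4 == 0.
    apply/eqP; apply: (cluster_eq0 clu cT (objective_decrement_cvg0 C4)) => n.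
    rewrite ger0_norm; first by case: (generated_descent n).
    by rewrite -[4%N]/(2 * 2)%N exprM sqr_ge0.
  by rewrite expf_eq0.
split=> //; exists (gradQ p); first exact: riemannian_grad_tangent_proj.
by rewrite /frob_norm Gp Tp /frob_dot mulmx0 mxtrace0 sqrtr0 addr0.
Qed.

(** The sum [s n] of both squared gradient norms at [u n.+1] is bounded by a
    decrement of [g], as the two bounds of [generated_descent] concern
    consecutive steps.  Hence one of the first [N] values of [s] is at most
    [K / N]. *)
Lemma hitting_time_le (e : R) : 0 < lamTheta -> 0 < e -> e < 1 ->
  (hitting_time X t e u <=
    ((2 * ((CQ + C2 / lamTheta) * energy_bound k X) + 1) * e ^- 2)%:E)%E.
Proof.
move=> lam0 e0 e1.
set K := _ * energy_bound _ _.
pose s n := frob_dot (gradQ (u n.+1)) (gradQ (u n.+1)) +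
            frob_dot (gradTheta n.+1) (gradTheta n.+1).
pose g n := CQ * f n.+1 + C2 / lamTheta * f n.
have sg n : s n <= g n - g n.+1.
  have [_ _ _ hT] := generated_descent n.
  have [_ hQ _ _] := generated_descent n.+1.
  move: hT; rewrite -ler_pdivlMl// mulrA [X in X * _]mulrC => hT.
  rewrite /s /g; apply: le_trans (lerD hQ hT) _.
  by move: (f n) (f n.+1) (f n.+2) => a b c; lra.
have [CQ0 _ C20] := bounds_ge0.
have gK N : g 0%N - g N <= K.
  have h m n : f m - f n <= energy_bound k X.
    have := objective_ge X t (u n).2 (generated_stiefel n).
    by have := objective_le0 X t (u m).1 (u m).2; move: (f m) (f n) => a b; lra.
  have C20' : 0 <= C2 / lamTheta by rewrite divr_ge0.
  have := ler_wpM2l CQ0 (h 1%N N.+1); have := ler_wpM2l C20' (h 0%N N).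
  rewrite /g /K; move: (f 0%N) (f 1%N) (f N) (f N.+1) => a b c e'; lra.
have K0 : 0 <= K by apply: le_trans (gK 0%N); rewrite subrr.
(* The least [N] with [2 * K / N < e ^+ 2]. *)
pose N := (Num.trunc (2 * K / e ^+ 2)).+1.
have e20 : 0 < e ^+ 2 by rewrite exprn_gt0.
have /andP[Nlo Nhi] := truncn_itv (divr_ge0 (mulr_ge0 (ler0n _ 2) K0) (ltW e20)).
have [n nN snK] : exists2 n, (n < N)%N & N%:R * s n <= K.
  apply: contrapT => /forall2NP no.
  have : \sum_(0 <= n < N) K < \sum_(0 <= n < N) N%:R * s n.
    apply: ltr_sum_nat => // n /andP[_ nN].
    by have [//|/negP] := no n; rewrite -ltNge.
  rewrite -mulr_sumr [X in X < _]sumr_const_nat subn0 -[X in X < _]mulr_natl.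
  rewrite ltr_pM2l ?ltr0n//.
  apply/negP; rewrite -leNgt; apply: le_trans (gK N).
  have -> : g 0%N - g N = \sum_(0 <= n < N) (g n - g n.+1).
    rewrite -[LHS]opprB -telescope_sumr// -sumrN.
    by apply: eq_bigr => i _; rewrite opprB.
  by apply: ler_sum_nat.
apply: (@le_trans _ _ (n.+1%:R%:E)).
  apply: ereal_inf_lbound; exists n.+1 => //; split=> //.
  split; first exact: generated_stiefel.
  exists (gradQ (u n.+1)).
    exact/riemannian_grad_tangent_proj/generated_stiefel.
  rewrite -ler_sqr ?nnegrE ?(ltW e0) ?addr_ge0 ?frob_norm_ge0//.
  set a := frob_norm _; set b := frob_norm _.
  have ab : (a + b) ^+ 2 <= 2 * s n.
    by rewrite /s -!sqr_frob_norm -/a -/b; have := sqr_ge0 (a - b); lra.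
  apply: le_trans ab _.
  rewrite -(ler_pM2l (_ : 0 < N%:R)) ?ltr0n//.
  apply: (@le_trans _ _ (2 * K)); first lra.
  by rewrite -ler_pdivrMr// ltW.
rewrite lee_fin; apply: (@le_trans _ _ N%:R); first by rewrite ler_nat.
rewrite /N -natr1 [leRHS]mulrDl mul1r lerD//.
by rewrite invf_ge1// expr_le1// ltW.
Qed.

End Run.
End Convergence.

Theorem corollary5p1 (R : realType) (d l k T : nat)
    (X : 'I_T -> 'M[R]_(d, l)) (t : 'I_T -> R)
    (ht : forall i, 0 <= t i <= 1)
    (lamQ lamTheta : R) (hlamQ : 0 <= lamQ) (hlamTheta : 0 <= lamTheta) :
  (forall u : nat -> 'M[R]_(d, k + k) * 'rV[R]_k,
     generated X t lamQ lamTheta u ->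
     forall p : 'M[R]_(d, k + k) * 'rV[R]_k, cluster (u @ \oo) p -> stationary X t p) /\
  (0 < lamQ -> 0 < lamTheta ->
     soft_bigO (@iter_complexity R d l k T X t lamQ lamTheta)
       (fun e : R => e ^- 2)).
Proof.
split=> [u gen p clu|lamQ_gt0 lamTheta_gt0].
  exact: cluster_stationary ht hlamQ hlamTheta _ gen _ clu.
exists (2 * ((2 * singular_bound k X lamQ +
  slope2_bound k X lamTheta / lamTheta) * energy_bound k X) + 1), 0%N.
near=> e; rewrite expr0 mulr1; apply/ereal_supP => _ [u gen <-].
have e0 : 0 < e by near: e; exact: nbhs_right_gt.
have e1 : e < 1 by near: e; exact: nbhs_right_lt.
exact: hitting_time_le.
Unshelve. all: by end_near. Qed.
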